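(* Assume (A1)--(A3). Let $\bar{\boldsymbol{\lambda}}^0=\mathbf{0}$. Then, the parameter $\rho^*$ minimizing the bound (the right-hand side, as a function of $\rho>0$) in $$\sum_{i=1}^N\rho\|\mathbf{A}_i(\mathbf{x}_i^0-\mathbf{x}_i^* )\|^2+\frac1\rho\le\rho N\sigma_{\max}^2(\mathbf{A})D_{\mathcal{X}}^2+\frac1\rho$$ is $$\rho^*=\frac{1}{\sqrt N\,\sigma_{\max}(\mathbf{A})D_{\mathcal{X}}}.$$ Furthermore, the number of iterations required to decrease the bound $$F(\tilde{\mathbf{x}}^k)-F(\mathbf{x}^* )+\|\mathbf{r}(\tilde{\mathbf{x}}^k)\|\le\frac{1}{2k\tau}\phi,\qquad \phi=\sum_{i=1}^N\rho\|\mathbf{A}_i(\mathbf{x}_i^0-\mathbf{x}_i^* )\|^2+\frac1\rho\big(\|\bar{\boldsymbol{\lambda}}^0\|+1\big)^2,$$ less than $\epsilon$ is $$k_{\epsilon,1}=\left\lceil\frac{\sqrt N\,\sigma_{\max}(\mathbf{A})D_{\mathcal{X}}}{\epsilon\tau}\right\rceil.$$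
   Context: Problem: minimize $F(\mathbf{x})=\sum_{i=1}^N f_i(\mathbf{x}_i)$ subject to $\sum_{i=1}^N\mathbf{A}_i\mathbf{x}_i=\mathbf{b}$ and $\mathbf{x}_i\in\mathcal{X}_i$, $i=1,\dots,N$. Here $f_i:\mathbb{R}^{n_i}\to\mathbb{R}$, $\mathcal{X}_i\subseteq\mathbb{R}^{n_i}$, $\mathbf{A}_i\in\mathbb{R}^{m\times n_i}$, $\mathbf{b}\in\mathbb{R}^m$, $n=\sum_{i=1}^N n_i$, $\mathbf{x}=[\mathbf{x}_1^\top,\dots,\mathbf{x}_N^\top]^\top\in\mathbb{R}^n$, $\mathbf{A}=[\mathbf{A}_1\dots\mathbf{A}_N]\in\mathbb{R}^{m\times n}$, $\mathcal{X}=\mathcal{X}_1\times\dots\times\mathcal{X}_N$. The Lagrangian is $L(\mathbf{x},\boldsymbol{\lambda})=F(\mathbf{x})+\langle\boldsymbol{\lambda},\mathbf{A}\mathbf{x}-\mathbf{b}\rangle$. The residual is $\mathbf{r}(\mathbf{x})=\mathbf{A}\mathbf{x}-\mathbf{b}$. Norms are Euclidean. $D_{\mathcal{X}}=\max_{\mathbf{x},\mathbf{y}\in\mathcal{X}}\|\mathbf{x}-\mathbf{y}\|$, and $\sigma_{\max}(\mathbf{A})$ is the maximum singular value of $\mathbf{A}$. Degree: for each $j=1,\dots,m$ let $q_j$ be the number of indices $i$ such that the $j$-th row of $\mathbf{A}_i$ is nonzero; $q=\max_j q_j$. ADAL (Accelerated Distributed Augmented Lagrangians) with penalty parameter $\rho>0$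 and stepsize $\tau\in(0,1/q)$: given initial Lagrange multipliers $\boldsymbol{\lambda}^0$ and initial primal variables $\mathbf{x}^0$, for $k=0,1,2,\dots$: (1) for every $i$, $\hat{\mathbf{x}}_i^k$ is determined as the solution of the subproblem $\min_{\mathbf{x}_i\in\mathcal{X}_i}\ f_i(\mathbf{x}_i)+\langle\boldsymbol{\lambda}^k,\mathbf{A}_i\mathbf{x}_i\rangle+\frac\rho2\big\|\mathbf{A}_i\mathbf{x}_i+\sum_{j\ne i}\mathbf{A}_j\mathbf{x}_j^k-\mathbf{b}\big\|^2$; (2) $\mathbf{x}_i^{k+1}=\mathbf{x}_i^k+\tau(\hat{\mathbf{x}}_i^k-\mathbf{x}_i^k)$ for every $i$; (3) if $\sum_{i=1}^N\mathbf{A}_i\mathbf{x}_i^{k+1}=\mathbf{b}$ and $\mathbf{A}_i\hat{\mathbf{x}}_i^k=\mathbf{A}_i\mathbf{x}_i^k$ for all $i$, stop (optimal solution found); otherwise set $\boldsymbol{\lambda}^{k+1}=\boldsymbol{\lambda}^k+\rho\tau\big(\sum_{i=1}^N\mathbf{A}_i\mathbf{x}_i^{k+1}-\mathbf{b}\big)$ and continue. Auxiliary dual variable: $\bar{\boldsymbol{\lambda}}^k=\boldsymbol{\lambda}^k+\rho(1-\tau)\mathbf{r}(\mathbf{x}^k)$. Ergodic average of the primal variables up to iteration $k$: $\tilde{\mathbf{x}}^k=\frac1k\sum_{p=0}^{k-1}\hat{\mathbf{x}}^p$. With $\bar{\boldsymbol{\lambda}}^0=\mathbf{0}$, $\phi$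 equals the left-hand side of the first displayed inequality of the claim. The iteration count refers to the choice $\rho=\rho^*$. Assumptions: (A1) the functions $f_i$ are convex (not necessarily differentiable) and the sets $\mathcal{X}_i$ are convex, closed and bounded for all $i$. (A2) $L$ has a saddle point $(\mathbf{x}^*,\boldsymbol{\lambda}^* )\in\mathbb{R}^n\times\mathbb{R}^m$, i.e. $L(\mathbf{x}^*,\boldsymbol{\lambda})\le L(\mathbf{x}^*,\boldsymbol{\lambda}^* )\le L(\mathbf{x},\boldsymbol{\lambda}^* )$ for all $\mathbf{x}\in\mathcal{X}$, $\boldsymbol{\lambda}\in\mathbb{R}^m$; in particular $\mathbf{x}^*$ is a solution of the problem. (A3) All subproblems in step (1) are exactly solvable at every iteration.
   Formalization: The initial point x^0 is assumed to lie in X (the first inequality fails otherwise), ''less than ε'' is read as ''at most ε'' (strictness fails when the ratio is an integer), and σ_max(A)·D_X > 0 is assumed for ρ* and the iteration count, which refers to the worst-case bound. *)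

(* Defs.v *)
From HB Require Import structures.
From mathcomp Require Import all_boot all_order all_algebra.
From mathcomp Require Import all_classical all_reals all_analysis.
Set Implicit Arguments.
Unset Strict Implicit.
Unset Printing Implicit Defensive.
Import Order.TTheory GRing.Theory Num.Theory.
Import numFieldNormedType.Exports.
Local Open Scope classical_set_scope.
Local Open Scope ring_scope.

Section Euclidean.
Context {R : realType}.

Definition dot (d : nat) (u v : 'cV[R]_d) : R := \sum_(j < d) u j 0 * v j 0.

(* The library norm `|v| on matrices is the max norm. *)
Definition enorm (d : nat) (v : 'cV[R]_d) : R := Num.sqrt (dot v v).

Definition singular_value (m d : nat) (M : 'M[R]_(m, d)) (s : R) : Prop :=
  0 <= s /\ eigenvalue (M^T *m M) (s ^+ 2).

(* The set of singular values is finite, so for d > 0 the sup is a max. *)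
Definition sigma_max (m d : nat) (M : 'M[R]_(m, d)) : R :=
  sup [set s | singular_value M s].

Definition argmin_on (T : Type) (D : set T) (g : T -> R) (x : T) : Prop :=
  D x /\ (forall y, D y -> g x <= g y).

End Euclidean.

Section Problem.
Context {R : realType} {N m : nat} {n : 'I_N -> nat}.

(* A point (x_1, ..., x_N) of R^(n_1) x ... x R^(n_N), kept as its family of
   blocks; [stack] is the corresponding vector of R^(n_1 + ... + n_N). *)
Definition blocks := forall i : 'I_N, 'cV[R]_(n i).

Implicit Types (f : forall i, 'cV[R]_(n i) -> R) (A : forall i, 'M[R]_(m, n i)).
Implicit Types (X : forall i, set 'cV[R]_(n i)) (b lam : 'cV[R]_m).
Implicit Types (x y : blocks) (rho tau : R).

Definition stack x : 'cV[R]_(\sum_i n i) := \mxcol_i x i.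

Definition full_mx A : 'M[R]_(m, \sum_i n i) := \mxrow_i A i.

Definition in_prod X x : Prop := forall i, X i (x i).

Definition objective f x : R := \sum_i f i (x i).

Definition residual A b x : 'cV[R]_m := full_mx A *m stack x - b.

Definition lagrangian f A b x lam : R :=
  objective f x + dot lam (residual A b x).

Definition saddle_point f X A b x lam : Prop :=
  [/\ in_prod X x,
      forall lam', lagrangian f A b x lam' <= lagrangian f A b x lam &
      forall x', in_prod X x' ->
        lagrangian f A b x lam <= lagrangian f A b x' lam].

(* A max when X is nonempty and compact. *)
Definition diameter X : R :=
  sup [set d | exists x y,
        [/\ in_prod X x, in_prod X y & d = enorm (stack x - stack y)]].

Definition degree A : nat :=
  (\max_(j < m) #|[pred i : 'I_N | row j (A i) != 0%R]|)%N.

Definition local_AL f A b rho lam x i (z : 'cV[R]_(n i)) : R :=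
  f i z + dot lam (A i *m z)
  + rho / 2 * enorm (A i *m z + \sum_(j | j != i) A j *m x j - b) ^+ 2.

Definition adal_stop A b (x xhat : nat -> blocks) (k : nat) : Prop :=
  \sum_i A i *m x k.+1 i = b /\
  (forall i, A i *m xhat k i = A i *m x k i).

(* Iteration k takes place iff no earlier iteration met the stopping test. *)
Definition adal_reaches A b (x xhat : nat -> blocks) (k : nat) : Prop :=
  forall p, (p < k)%N -> ~ adal_stop A b x xhat p.

(* Entries of the sequences beyond the stopping iteration are unconstrained. *)
Definition adal f X A b rho tau (x xhat : nat -> blocks)
    (lam : nat -> 'cV[R]_m) : Prop :=
  forall k, adal_reaches A b x xhat k ->
    [/\ forall i, argmin_on (X i) (local_AL f A b rho (lam k) (x k) (i := i))
                    (xhat k i),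
        forall i, x k.+1 i = x k i + tau *: (xhat k i - x k i) &
        ~ adal_stop A b x xhat k ->
        lam k.+1 = lam k + (rho * tau) *: (\sum_i A i *m x k.+1 i - b)].

Definition lam_bar A b rho tau x lam : 'cV[R]_m :=
  lam + (rho * (1 - tau)) *: residual A b x.

Definition ergodic (xhat : nat -> blocks) (k : nat) : blocks :=
  fun i => k%:R^-1 *: \sum_(p < k) xhat p i.

(* [lbar0] is the initial auxiliary multiplier lam_bar ... x0 lam0. *)
Definition phi A rho (x0 xs : blocks) (lbar0 : 'cV[R]_m) : R :=
  \sum_i rho * enorm (A i *m (x0 i - xs i)) ^+ 2
  + rho^-1 * (enorm lbar0 + 1) ^+ 2.

Definition rho_bound X A rho : R :=
  rho * N%:R * sigma_max (full_mx A) ^+ 2 * diameter X ^+ 2 + rho^-1.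

Definition rho_opt X A : R :=
  (Num.sqrt N%:R * sigma_max (full_mx A) * diameter X)^-1.

Definition k_eps X A tau (eps : R) : int :=
  Num.ceil (Num.sqrt N%:R * sigma_max (full_mx A) * diameter X / (eps * tau)).

End Problem.

Arguments blocks R {N} n.

(* Main.v *)
Require Import Defs.
From HB Require Import structures.
From mathcomp Require Import all_boot all_order all_algebra.
From mathcomp Require Import all_classical all_reals all_analysis.
From mathcomp Require Import ring lra.
Set Implicit Arguments.
Unset Strict Implicit.
Import Order.TTheory GRing.Theory Num.Theory.
Import numFieldNormedType.Exports.
Local Open Scope classical_set_scope.
Local Open Scope ring_scope.

(** The heart of the matter is a Lyapunov argument along the iterates. For a
    fixed multiplier mu, consider
      V_k(mu) = sum_i rho |A_i (x_i^k - x*_i)|^2 + rho^-1 |lbar^k - mu|^2 .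
    Optimality of each local subproblem, in the variational form given by
    convexity ([local_AL_first_order]), is tested at x*_i and summed over i.
    Because lbar^{k+1} = lbar^k + rho tau r(xhat^k), the cross terms of V_{k+1}
    match those of the summed inequality, and what remains is bounded by
      rho tau (tau |sum_i u_i|^2 + (tau - 2) sum_i |u_i|^2)
    with u_i = A_i (xhat_i - x_i). Each constraint row couples at most q
    blocks, so |sum_i u_i|^2 <= q sum_i |u_i|^2 ([dot_sum_le_degree]), and
    tau q <= 1, tau <= 1 make this remainder nonpositive. Hence
    ([potential_decrease])
      2 tau (F(xhat^k) - F(x* ) + <mu, r(xhat^k)>) <= V_k(mu) - V_{k+1}(mu) .
    Telescoping and Jensen's inequality transfer the estimate to the ergodic
    average ([ergodic_lagrangian_gap]); choosing mu as the unit vector in the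
    direction of the ergodic residual turns <mu, r> into the norm of r
    ([ergodic_rate]).

    The bound on the initial potential needs that sigma_max A, a supremum of
    square roots of eigenvalues of A^T A, really is the operator norm
    ([enorm_mulmx_sigma_max]). This is the variational characterisation of the
    top eigenvalue: the Rayleigh quotient attains its maximum on the compact
    unit sphere, and the maximiser is an eigenvector by first-order
    optimality. The single-block estimate follows by padding a block with
    zeros.

    Finally, with a = sqrt N * sigma_max A * D, the bound is
    rho a^2 + 1/rho = 2 a + (rho a - 1)^2 / rho, minimal exactly at
    rho = 1/a with value 2 a, and (2 k tau)^-1 (2 a) <= eps unfolds to
    a / (eps tau) <= k. *)

(** * Euclidean inner product and first-order optimality *)

Section DotProduct.
Context {R : realType}.

Lemma dotC d (u v : 'cV[R]_d) : dot u v = dot v u.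
Proof. by apply: eq_bigr => j _; rewrite mulrC. Qed.

Lemma dotDl d (u v w : 'cV[R]_d) : dot (u + v) w = dot u w + dot v w.
Proof. by rewrite -big_split; apply: eq_bigr => j _; rewrite mxE mulrDl. Qed.

Lemma dotZl d a (u w : 'cV[R]_d) : dot (a *: u) w = a * dot u w.
Proof. by rewrite mulr_sumr; apply: eq_bigr => j _; rewrite mxE mulrA. Qed.

Lemma dotNl d (u w : 'cV[R]_d) : dot (- u) w = - dot u w.
Proof. by rewrite -scaleN1r dotZl mulN1r. Qed.

Lemma dotBl d (u v w : 'cV[R]_d) : dot (u - v) w = dot u w - dot v w.
Proof. by rewrite dotDl dotNl. Qed.

Lemma dotDr d (u v w : 'cV[R]_d) : dot w (u + v) = dot w u + dot w v.
Proof. by rewrite dotC dotDl !(dotC w). Qed.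

Lemma dotZr d a (u w : 'cV[R]_d) : dot w (a *: u) = a * dot w u.
Proof. by rewrite dotC dotZl (dotC w). Qed.

Lemma dotNr d (u w : 'cV[R]_d) : dot w (- u) = - dot w u.
Proof. by rewrite dotC dotNl (dotC w). Qed.

Lemma dot0l d (w : 'cV[R]_d) : dot 0 w = 0.
Proof. by rewrite -(scale0r w) dotZl mul0r. Qed.

Definition dotE := (dotDl, dotDr, dotNl, dotNr, dotZl, dotZr).

Lemma dot_sumr d (I : finType) (w : 'cV[R]_d) (u : I -> 'cV[R]_d) :
  dot w (\sum_i u i) = \sum_i dot w (u i).
Proof.
rewrite exchange_big /=; apply: eq_bigr => j _.
by rewrite summxE mulr_sumr.
Qed.

Lemma dot_ge0 d (u : 'cV[R]_d) : 0 <= dot u u.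
Proof. by apply: sumr_ge0 => j _; rewrite -expr2 sqr_ge0. Qed.

Lemma dot_eq0 d (u : 'cV[R]_d) : (dot u u == 0) = (u == 0).
Proof.
apply/idP/eqP => [/eqP h|->]; last by rewrite dot0l.
apply/matrixP => i j; rewrite ord1 mxE; apply/eqP.
have sq_ge0 (l : 'I_d) : predT l -> 0 <= u l 0 * u l 0.
  by move=> _; rewrite -expr2 sqr_ge0.
by have /eqP := psumr_eq0P sq_ge0 h (erefl : predT i); rewrite mulf_eq0 orbb.
Qed.

Lemma enorm_sqr d (u : 'cV[R]_d) : enorm u ^+ 2 = dot u u.
Proof. by rewrite sqr_sqrtr// dot_ge0. Qed.

Lemma enorm_ge0 d (u : 'cV[R]_d) : 0 <= enorm u.
Proof. exact: sqrtr_ge0. Qed.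

Lemma enorm0 d : enorm (0 : 'cV[R]_d) = 0.
Proof. by rewrite /enorm dot0l sqrtr0. Qed.

Lemma enorm_eq0 d (u : 'cV[R]_d) : (enorm u == 0) = (u == 0).
Proof. by rewrite -(sqrf_eq0 (enorm u)) enorm_sqr dot_eq0. Qed.

Lemma dot_normalize d (v : 'cV[R]_d) : dot ((enorm v)^-1 *: v) v = enorm v.
Proof.
rewrite dotZl -enorm_sqr expr2; have [->|v0] := eqVneq (enorm v) 0.
  by rewrite !mulr0.
by rewrite mulKf.
Qed.

Lemma enorm_normalize_le1 d (v : 'cV[R]_d) : enorm ((enorm v)^-1 *: v) <= 1.
Proof.
rewrite -(@expr_le1 _ 2) ?enorm_ge0// enorm_sqr dotZr dot_normalize.
by have [->|v0] := eqVneq (enorm v) 0; rewrite ?mulr0 ?ler01// mulVf.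
Qed.

Lemma dot_mulmx d e (M : 'M[R]_(e, d)) u v : dot (M *m u) v = dot u (M^T *m v).
Proof.
transitivity (\sum_(j < e) \sum_(l < d) M j l * u l 0 * v j 0).
  by apply: eq_bigr => j _; rewrite mxE mulr_suml.
rewrite exchange_big; apply: eq_bigr => l _ /=; rewrite mxE mulr_sumr.
by apply: eq_bigr => j _; rewrite mxE mulrCA mulrA.
Qed.

(** Dividing by t and letting t tend to 0; stated with an arbitrary quadratic
    remainder because all directional expansions below are exactly quadratic. *)
Lemma first_order_ge0 (a c : R) :
  (forall t, 0 < t <= 1 -> 0 <= t * a + t ^+ 2 * c) -> 0 <= a.
Proof.
move=> h; rewrite leNgt; apply/negP => a0.
set D := `|c| - a; have D0 : 0 < D by rewrite subr_gt0 (lt_le_trans a0).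
(* t makes the linear term dominate, and D >= - a keeps t below 1 *)
pose t := - a / (2 * D).
have t0 : 0 < t by rewrite divr_gt0 ?mulr_gt0// oppr_gt0.
have tD : t * D = - a / 2 by rewrite /t; field; rewrite gt_eqF.
have t1 : t <= 1.
  rewrite ler_pdivrMr ?mulr_gt0// mul1r /D.
  by have := normr_ge0 c; lra.
have := h t; rewrite t0 t1 expr2 -mulrA -mulrDr => /(_ isT).
rewrite pmulr_rge0// => ge0.
have : t * c <= t * D.
  by rewrite ler_pM2l// /D; have := ler_norm c; lra.
by rewrite tD; lra.
Qed.

End DotProduct.

(** * The largest singular value is the operator norm *)

Section OperatorNorm.
Context {R : realType}.

Lemma dot_continuous d e (g h : 'rV[R]_d -> 'cV[R]_e) :
  (forall j, continuous (fun w => g w j 0)) ->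
  (forall j, continuous (fun w => h w j 0)) ->
  continuous (fun w => dot (g w) (h w)).
Proof.
move=> cg ch; rewrite /dot; apply: continuous_big => [|j _ w].
  exact: add_continuous.
apply: (@continuousM _ _ (fun w => g w j 0) (fun w => h w j 0)).
  exact: cg.
exact: ch.
Qed.

Lemma mulmx_tr_continuous d e (M : 'M[R]_(e, d)) (j : 'I_e) :
  continuous (fun w : 'rV[R]_d => (M *m w^T) j 0).
Proof.
rewrite (_ : (fun _ => _) = fun w : 'rV[R]_d => \sum_l M j l * w 0 l).
  apply: continuous_big => [|l _ w]; first exact: add_continuous.
  by exact (@continuousM R 'rV[R]_d (fun=> M j l) (fun w => w 0 l) w
    (@cst_continuous 'rV[R]_d R (M j l) w) (@coord_continuous R 1 d 0 l w)).
by apply/funext => u; rewrite mxE; apply: eq_bigr => l _; rewrite mxE.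
Qed.

(** Compactness of the unit sphere; homogeneity then extends the
    estimate from the sphere to all u. The points of the sphere are row vectors,
    the form in which the extreme value theorem is stated. *)
Lemma rayleigh_max d e (M : 'M[R]_(e, d.+1)) :
  exists2 v : 'cV[R]_d.+1, dot v v = 1 &
    forall u, dot (M *m u) (M *m u) <= dot (M *m v) (M *m v) * dot u u.
Proof.
pose S := [set w : 'rV[R]_d.+1 | dot w^T w^T = 1].
pose g (w : 'rV[R]_d.+1) := dot (M *m w^T) (M *m w^T).
have trc (j : 'I_d.+1) : continuous (fun w : 'rV[R]_d.+1 => w^T j 0).
  move=> w; rewrite (_ : (fun _ => _) = fun w : 'rV[R]_d.+1 => w 0 j).
    exact: coord_continuous.
  by apply/funext => u; rewrite mxE.
have S0 : S !=set0.
  exists (delta_mx 0 0); rewrite /S /= /dot (bigD1 ord0)//= big1 => [|j j0].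
    by rewrite !mxE !eqxx mulr1 addr0.
  by rewrite !mxE (negPf j0) mul0r.
have Sclosed : closed S.
  rewrite (_ : S = (fun w : 'rV[R]_d.+1 => dot w^T w^T) @^-1` [set 1])//.
  by apply: preimage_closed => [w _|]; [exact: dot_continuous|exact: closed_eq].
have Sbounded : bounded_set S.
  exists 1; split=> // r r1 w /= Sw; apply: le_trans (ltW r1).
  rewrite [leLHS]/Num.norm /= mx_normrE; apply: bigmax_le => // -[i j] _ /=.
  rewrite ord1 -(@ler_pXn2r _ 2)// ?nnegrE// expr1n real_normK ?num_real//.
  rewrite -Sw /dot (bigD1 j)//= !mxE -expr2 lerDl sumr_ge0// => l _.
  by rewrite -expr2 sqr_ge0.
have [|w Sw wmax] := EVT_max_rV S0 (bounded_closed_compact Sbounded Sclosed)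
    (f := g).
  apply: continuous_subspaceT => w.
  by apply: dot_continuous => j; exact: mulmx_tr_continuous.
exists w^T; first by move: Sw; rewrite inE.
move=> u; have [->|u0] := eqVneq u 0; first by rewrite mulmx0 !dot0l mulr0.
have nu : 0 < enorm u by rewrite lt0r enorm_eq0 u0 enorm_ge0.
have : g ((enorm u)^-1 *: u)^T <= g w.
  apply: wmax; rewrite inE /S /= trmxK !dotE -enorm_sqr; field.
  by rewrite gt_eqF.
rewrite /g trmxK -scalemxAr !dotE mulrA -invfM -expr2 mulrC ler_pdivrMr.
  by rewrite enorm_sqr.
by rewrite exprn_gt0.
Qed.

(** The form c |u|^2 - |M u|^2 is nonnegative and vanishes at v, so its gradient
    there is zero; the perturbation of v along the defect p shows |p|^2 <= 0. *)
Lemma rayleigh_eigen d e (M : 'M[R]_(e, d)) (c : R) v :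
  (forall u, dot (M *m u) (M *m u) <= c * dot u u) ->
  dot (M *m v) (M *m v) = c * dot v v -> M^T *m (M *m v) = c *: v.
Proof.
move=> cmax cv; pose p := M^T *m (M *m v) - c *: v.
have pE : dot p p = dot (M *m v) (M *m p) - c * dot v p.
  by rewrite {1}/p dotBl dotZl dot_mulmx trmxK.
suff p0 : 0 <= - dot p p.
  have : dot p p == 0 by rewrite eq_le dot_ge0 andbT -oppr_ge0.
  by rewrite dot_eq0 subr_eq0 => /eqP.
clearbody p.
apply: (@first_order_ge0 _ _ ((c * dot p p - dot (M *m p) (M *m p)) / 2)).
move=> t _; have := cmax (v + t *: p).
rewrite mulmxDr -scalemxAr !dotE.
rewrite (dotC (M *m p) (M *m v)) (dotC p v) cv pE => h.
by rewrite -(@pmulr_rge0 _ 2)//; lra.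
Qed.

(** A set without a least upper bound has supremum 0 by convention. *)
Lemma sup_ge0 (S : set R) : (forall s, S s -> 0 <= s) -> 0 <= sup S.
Proof.
move=> S_ge0; have [[[s Ss] ubS]|/sup_out-> //] := pselect (has_sup S).
exact: le_trans (S_ge0 s Ss) (ub_le_sup ubS Ss).
Qed.

Lemma sigma_max_ge0 d e (M : 'M[R]_(e, d)) : 0 <= sigma_max M.
Proof. by apply: sup_ge0 => s []. Qed.

(** The maximum s of |M v| over the unit sphere is itself a singular value, and
    evaluating |M w| on an eigenvector w shows that no singular value exceeds s.
    In dimension 0 there are no eigenvectors, and both sides vanish. *)
Lemma enorm_mulmx_sigma_max d e (M : 'M[R]_(e, d)) u :
  enorm (M *m u) <= sigma_max M * enorm u.
Proof.
case: d M u => [|d] M u.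
  by rewrite [u]flatmx0 mulmx0 !enorm0 mulr0.
have [v v1 vmax] := rayleigh_max M.
set s := enorm (M *m v).
have sE : s ^+ 2 = dot (M *m v) (M *m v) by rewrite enorm_sqr.
have Ss : singular_value M s.
  split; first exact: enorm_ge0.
  apply/eigenvalueP; exists v^T; last by rewrite trmx_eq0 -dot_eq0 v1 oner_eq0.
  apply: trmx_inj; rewrite trmx_mul linearZ /= trmx_mul !trmxK -mulmxA.
  by rewrite sE; apply: rayleigh_eigen; rewrite // v1 mulr1.
have ubs : ubound [set t | singular_value M t] s.
  move=> t [t0 /eigenvalueP[w wE w0]].
  have {wE} : M^T *m (M *m w^T) = t ^+ 2 *: w^T.
    apply: trmx_inj; rewrite trmx_mul linearZ /= trmx_mul !trmxK -wE.
    by rewrite mulmxA.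
  move=> /(congr1 (dot w^T)); rewrite -dot_mulmx dotZr => wE.
  have w_gt0 : 0 < dot w^T w^T by rewrite lt0r dot_ge0 dot_eq0 trmx_eq0 w0.
  rewrite -(@ler_pXn2r _ 2) ?nnegrE ?enorm_ge0// -(@ler_pM2r _ _ w_gt0).
  by rewrite -wE sE.
have -> : sigma_max M = s.
  apply/eqP; rewrite eq_le; apply/andP; split.
    by apply: ge_sup => //; exists s.
  by apply: ub_le_sup => //; exists s.
rewrite -(@ler_pXn2r _ 2) ?nnegrE ?mulr_ge0 ?enorm_ge0//.
by rewrite exprMn !enorm_sqr.
Qed.

End OperatorNorm.

(** * Convex combinations *)

Section ConvexCombination.
Context {R : realType} {E : lmodType R}.

Lemma convex_function_le (f : E -> R) (t : R) x y :
  convex_function setT f -> 0 <= t <= 1 ->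
  f (t *: x + (1 - t) *: y) <= t * f x + (1 - t) * f y.
Proof.
move=> cf /andP[t0 t1].
by have /= := cf (Itv01 t0 t1) x y; rewrite !in_setT; exact.
Qed.

Lemma convex_set_mem (D : set E) (t : R) x y :
  convex_set D -> D x -> D y -> 0 <= t <= 1 -> D (t *: x + (1 - t) *: y).
Proof.
move=> cD Dx Dy /andP[t0 t1].
by have /= := cD x y (Itv01 t0 t1); rewrite !inE; exact.
Qed.

(** Jensen's inequality with equal weights; the average of k+2 points is the
    combination of the average of the first k+1 with weight (k+1)/(k+2) and the
    last point. *)
Lemma convex_function_average (f : E -> R) (u : nat -> E) k :
  convex_function setT f -> (0 < k)%N ->
  f (k%:R^-1 *: \sum_(p < k) u p) <= k%:R^-1 * \sum_(p < k) f (u p).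
Proof.
move=> cf; case: k => // k _; elim: k => [|k IH].
  by rewrite !big_ord_recl !big_ord0 !addr0 invr1 scale1r mul1r.
have n1 : k.+1%:R != 0 :> R by rewrite pnatr_eq0.
have n2 : k.+2%:R != 0 :> R by rewrite pnatr_eq0.
have nS : k.+2%:R = k.+1%:R + 1 :> R by rewrite -[in LHS]addn1 natrD.
pose t : R := k.+1%:R / k.+2%:R.
have t01 : 0 <= t <= 1.
  by rewrite divr_ge0//= ler_pdivrMr ?ltr0n// mul1r ler_nat.
have tC : 1 - t = k.+2%:R^-1.
  by rewrite /t -[X in X - _](divff n2) -mulrBl {1}nS addrAC subrr add0r mul1r.
have tV : t * k.+1%:R^-1 = k.+2%:R^-1 by rewrite /t mulrAC divff ?mul1r.
rewrite big_ord_recr [in leRHS]big_ord_recr /= scalerDr mulrDr -{1 3}tV -tC.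
rewrite -scalerA -mulrA.
apply: le_trans (convex_function_le _ _ cf t01) _.
by rewrite lerD2r ler_wpM2l//; case/andP: t01.
Qed.

End ConvexCombination.

(** * Block vectors, diameter and degree *)

Section Blocks.
Context {R : realType} {N m : nat} {n : 'I_N -> nat}.
Implicit Types (A : forall i, 'M[R]_(m, n i)) (x y z : blocks R n).
Implicit Types (X : forall i, set 'cV[R]_(n i)).

Lemma diameter_ge0 X : 0 <= diameter X.
Proof. by apply: sup_ge0 => _ [x [y [_ _ ->]]]; exact: enorm_ge0. Qed.

Lemma dot_mx11 d (u v : 'cV[R]_d) : dot u v = (u^T *m v) 0 0.
Proof. by rewrite mxE; apply: eq_bigr => j _; rewrite mxE. Qed.

Lemma dot_stack x y : dot (stack x) (stack y) = \sum_i dot (x i) (y i).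
Proof.
rewrite dot_mx11 /stack tr_mxcol mul_mxrow_mxcol summxE.
by apply: eq_bigr => i _; rewrite dot_mx11.
Qed.

Lemma stackB x y : stack x - stack y = stack (fun i => x i - y i).
Proof. by rewrite /stack mxcolB. Qed.

Lemma residualE A b x : residual A b x = \sum_i A i *m x i - b.
Proof. by rewrite /residual /full_mx /stack mul_mxrow_mxcol. Qed.

(** A_i x_i is the image under the full matrix of x with all other blocks
    zeroed, and zeroing blocks does not increase the norm. *)
Lemma enorm_block_le A x i :
  enorm (A i *m x i) <= sigma_max (full_mx A) * enorm (stack x).
Proof.
pose y : blocks R n := fun j => if j == i then x j else 0.
have yi : full_mx A *m stack y = A i *m x i.
  rewrite /full_mx /stack mul_mxrow_mxcol (bigD1 i)//= big1 ?addr0.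
    by rewrite /y eqxx.
  by move=> j ji; rewrite /y (negPf ji) mulmx0.
rewrite -yi; apply: le_trans (enorm_mulmx_sigma_max _ _) _.
rewrite ler_wpM2l ?sigma_max_ge0// ler_wsqrtr// !dot_stack ler_sum// => j _.
by rewrite /y; case: ifP => // _; rewrite dot0l dot_ge0.
Qed.

(** Here [`|v|] is the max norm in which boundedness of the X_i is expressed. *)
Lemma coord_norm_le d (v : 'cV[R]_d) j : `|v j 0| <= `|v|.
Proof.
rewrite [leRHS]/Num.norm /= mx_normrE.
by apply/bigmax_geP; right; exists (j, 0).
Qed.

(** Boundedness of the blocks is what makes the defining supremum of the
    diameter an upper bound. *)
Lemma enorm_stackB_diameter X x y : (forall i, bounded_set (X i)) ->
  in_prod X x -> in_prod X y -> enorm (stack x - stack y) <= diameter X.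
Proof.
move=> bX Xx Xy; apply: ub_le_sup; last by exists x, y.
have /choice[M HM] : forall i, exists M, forall v, X i v -> `|v| <= M.
  move=> i; have [M0 [_ HM0]] := bX i; exists (M0 + 1).
  by move=> v Xv; apply: HM0 => //; rewrite ltrDl.
exists (Num.sqrt (\sum_i \sum_(j < n i) (M i + M i) ^+ 2)).
move=> _ [v [w [Xv Xw ->]]]; rewrite stackB.
apply: ler_wsqrtr; rewrite dot_stack; apply: ler_sum => i _.
apply: ler_sum => j _; rewrite -expr2 -[leLHS]real_normK ?num_real//.
rewrite ler_pXn2r ?nnegrE ?addr_ge0//; last first.
- exact: le_trans (HM i _ (Xv i)).
- exact: le_trans (HM i _ (Xv i)).
rewrite !mxE; apply: le_trans (ler_normB _ _) _.
by apply: lerD; apply: le_trans (coord_norm_le _ _) (HM i _ _).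
Qed.

(** Each single block difference is compared with the whole diameter; summing
    the N blocks separately is the origin of the factor N. *)
Lemma sum_enorm_le_rho_bound X A rho x y : (forall i, bounded_set (X i)) ->
  in_prod X x -> in_prod X y -> 0 < rho ->
  \sum_i rho * enorm (A i *m (x i - y i)) ^+ 2 + rho^-1 <= rho_bound X A rho.
Proof.
move=> bX Xx Xy rho0; rewrite lerD2r.
have -> : rho * N%:R * sigma_max (full_mx A) ^+ 2 * diameter X ^+ 2
    = \sum_(i < N) rho * (sigma_max (full_mx A) * diameter X) ^+ 2.
  by rewrite sumr_const card_ord -mulr_natr; ring.
apply: ler_sum => i _; rewrite ler_pM2l// ler_sqr ?nnegrE ?enorm_ge0//.
  apply: le_trans (enorm_block_le A (fun i => x i - y i) i) _.
  by rewrite ler_wpM2l ?sigma_max_ge0// -stackB enorm_stackB_diameter.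
by rewrite mulr_ge0 ?sigma_max_ge0 ?diameter_ge0.
Qed.

(** Cauchy-Schwarz against the indicator of P, read off from
    sum_(i in P) (s - q a_i)^2 >= 0 with s the sum of the a_i and q = #|P|. *)
Lemma sqr_sum_le_card (I : finType) (P : pred I) (a : I -> R) :
  (forall i, ~~ P i -> a i = 0) ->
  (\sum_i a i) ^+ 2 <= #|P|%:R * \sum_i a i ^+ 2.
Proof.
move=> aP; have sumP (g : I -> R) : (forall i, ~~ P i -> g i = 0) ->
    \sum_(i | P i) g i = \sum_i g i.
  by move=> g0; rewrite [RHS](bigID P) /= [X in _ + X]big1 ?addr0.
have [P0|Pn0] := eqVneq #|P| 0%N.
  rewrite big1 ?expr0n /= => [|i _]; last first.
    by apply: aP; have := card0_eq P0 i; rewrite unfold_in => ->.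
  by rewrite mulr_ge0// sumr_ge0// => i _; rewrite sqr_ge0.
have q0 : 0 < #|P|%:R :> R by rewrite ltr0n lt0n.
move qE : (#|P|%:R : R) q0 => q q0; move sE : (\sum_i a i) => s.
have : 0 <= \sum_(i | P i) (s - q * a i) ^+ 2.
  by apply: sumr_ge0 => i _; rewrite sqr_ge0.
have -> : \sum_(i | P i) (s - q * a i) ^+ 2
    = q * s ^+ 2 - 2 * q * s * s + q ^+ 2 * \sum_i a i ^+ 2.
  transitivity (\sum_(i | P i) s ^+ 2 - 2 * q * s * \sum_(i | P i) a i
     + q ^+ 2 * \sum_(i | P i) a i ^+ 2).
    by rewrite !mulr_sumr -sumrB -big_split /=; apply: eq_bigr => i _; ring.
  rewrite (sumP a)// (sumP (fun i => a i ^+ 2)) => [|i /aP ->]; last first.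
    by rewrite expr0n.
  by rewrite sumr_const sE -[_ *+ #|_|]mulr_natl -qE.
rewrite (_ : _ + _ = q * (q * (\sum_i a i ^+ 2) - s ^+ 2)); last by ring.
by rewrite pmulr_rge0// subr_ge0.
Qed.

(** Row j of the sum has at most q_j nonzero terms, one for each block coupled
    by constraint j, so Cauchy-Schwarz costs q_j instead of N. *)
Lemma dot_sum_le_degree A x :
  dot (\sum_i A i *m x i) (\sum_i A i *m x i)
    <= (degree A)%:R * \sum_i dot (A i *m x i) (A i *m x i).
Proof.
rewrite /dot exchange_big /= mulr_sumr; apply: ler_sum => j _.
rewrite -expr2 summxE.
apply: le_trans (@sqr_sum_le_card _ [pred i | row j (A i) != 0]
  (fun i => (A i *m x i) j 0) _) _ => [i|].
  rewrite /= negbK => /eqP Aij.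
  by have /matrixP/(_ 0 0) := row_mul j (A i) (x i); rewrite Aij mul0mx !mxE.
under [in leLHS]eq_bigr do rewrite expr2.
apply: ler_wpM2r; first by rewrite sumr_ge0// => i _; rewrite -expr2 sqr_ge0.
by rewrite ler_nat; exact: leq_bigmax j.
Qed.

End Blocks.

(** * Convergence of the iterates *)

Section ADAL.
(* the block index must remain an explicit argument of f, X and A *)
Unset Implicit Arguments.
Context {R : realType} {N m : nat} {n : 'I_N -> nat}.
Context (f : forall i : 'I_N, 'cV[R]_(n i) -> R).
Context (X : forall i : 'I_N, set 'cV[R]_(n i)).
Context (A : forall i : 'I_N, 'M[R]_(m, n i)) (b : 'cV[R]_m).
Context (f_convex : forall i, convex_function setT (f i)).
Context (X_convex : forall i, convex_set (X i)).
Context (rho : R).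
Set Implicit Arguments.

(** The subproblem is solved by xh, so moving from xh towards y by t cannot
    decrease its objective: f is bounded by convexity, the rest is a quadratic
    in t, and [first_order_ge0] extracts the linear coefficient. *)
Lemma local_AL_first_order (lam : 'cV[R]_m) (x : blocks R n) i xh y :
  argmin_on (X i) (local_AL f A b rho lam x (i := i)) xh -> X i y ->
  f i xh <= f i y
    + dot (lam + rho *: (A i *m xh + \sum_(j | j != i) A j *m x j - b))
          (A i *m (y - xh)).
Proof.
move=> [Xxh xh_min] Xy; rewrite -[_ + _ - b]addrA.
set c := \sum_(j | j != i) _ - b; set w := A i *m xh + c.
set d := A i *m (y - xh).
have ALE z : local_AL f A b rho lam x (i := i) z =
    f i z + dot lam (A i *m z) + rho / 2 * dot (A i *m z + c) (A i *m z + c).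
  by rewrite /local_AL enorm_sqr /c [A i *m z + (_ + _)]addrA.
rewrite -subr_ge0; apply: (@first_order_ge0 _ _ (rho / 2 * dot d d)).
move=> t /andP[t0 t1]; have t01 : 0 <= t <= 1 by rewrite (ltW t0) t1.
have := xh_min _ (convex_set_mem (X_convex i) Xy Xxh t01).
have := convex_function_le y xh (f_convex i) t01.
set z := t *: y + (1 - t) *: xh => fz.
have Az : A i *m z = A i *m xh + t *: d.
  rewrite /d scalemxAr -mulmxDr; congr (_ *m _).
  by rewrite /z scalerBr scalerBl scale1r addrCA addrC.
have Azc : A i *m z + c = w + t *: d by rewrite Az addrAC.
rewrite !ALE Azc Az -/w; clearbody w d z c.
rewrite !dotE (dotC d w); move: fz; lra.
Qed.

Context (tau : R) (xs : blocks R n).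
Context (xs_in : in_prod X xs) (xs_feasible : residual A b xs = 0).

(** The Lyapunov function V(mu); the multiplier mu is left free because it will
    be chosen only after the ergodic average is known. *)
Definition potential (mu : 'cV[R]_m) (x : blocks R n) (lbar : 'cV[R]_m) : R :=
  \sum_i rho * enorm (A i *m (x i - xs i)) ^+ 2
  + rho^-1 * enorm (lbar - mu) ^+ 2.

Lemma residualB x y :
  residual A b x - residual A b y = \sum_i A i *m (x i - y i).
Proof.
rewrite !residualE opprB addrA subrK -sumrB.
by apply: eq_bigr => i _; rewrite mulmxBr.
Qed.

Lemma residual_relax x xh x' : (forall i, x' i = x i + tau *: (xh i - x i)) ->
  residual A b x' = (1 - tau) *: residual A b x + tau *: residual A b xh.
Proof.
move=> x'E; rewrite !residualE !scalerBr addrACA -opprD -scalerDl subrK scale1r.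
congr (_ - _); rewrite !scaler_sumr -big_split /=; apply: eq_bigr => i _.
rewrite x'E mulmxDr -scalemxAr mulmxBr scalerBr scalerBl scale1r.
by rewrite addrCA addrC.
Qed.

Context (rho_gt0 : 0 < rho) (tau_gt0 : 0 < tau).
Context (tau_lt : tau < (degree A)%:R^-1).

(** A zero degree would make the interval of step sizes empty, so q >= 1 and
    tau < 1/q also gives tau <= 1. *)
Lemma stepsize_le : tau * (degree A)%:R <= 1 /\ tau <= 1.
Proof.
have q0 : (0 < degree A)%N.
  rewrite lt0n; apply/eqP => q0; move: tau_lt tau_gt0.
  by rewrite q0 invr0 => /ltW; rewrite leNgt => /negP.
have q1 : 1 <= (degree A)%:R :> R by rewrite ler1n.
have qp : 0 < (degree A)%:R :> R by rewrite ltr0n.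
have tq : tau * (degree A)%:R <= 1 by rewrite -ler_pdivlMr// div1r ltW.
by split=> //; apply: le_trans tq; rewrite ler_peMr// ltW.
Qed.

(** One step of the Lyapunov argument. With w_i = A_i (x_i - x*_i) and
    u_i = A_i (xhat_i - x_i), feasibility of x* gives sum_i w_i = r(x) and
    sum_i u_i = r(xhat) - r(x). *)
Lemma potential_decrease mu lam (x xh x' : blocks R n) lbar :
  (forall i, argmin_on (X i) (local_AL f A b rho lam x (i := i)) (xh i)) ->
  (forall i, x' i = x i + tau *: (xh i - x i)) ->
  lbar = lam_bar A b rho tau x lam ->
  potential mu x' (lbar + (rho * tau) *: residual A b xh)
    + 2 * tau * (objective f xh - objective f xs + dot mu (residual A b xh))
  <= potential mu x lbar.
Proof.
move=> xh_min x'E lbarE.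
pose w i := A i *m (x i - xs i); pose u i := A i *m (xh i - x i).
set r := residual A b x in lbarE *; set rh := residual A b xh.
have sumw : \sum_i w i = r.
  by rewrite -[r]subr0 -[X in r - X]xs_feasible residualB.
have sumu : \sum_i u i = rh - r by rewrite residualB.
pose U := \sum_i dot (u i) (u i); pose W := \sum_i dot (w i) (u i).
(* the variational inequalities of the subproblems, tested at xs and summed *)
have optimality : objective f xh
    <= objective f xs - dot (lam + rho *: r) rh - rho * W - rho * U.
  have -> : dot (lam + rho *: r) rh = \sum_i dot (lam + rho *: r) (w i + u i).
    by rewrite -dot_sumr big_split /= sumw sumu addrC subrK.
  rewrite /W /U !mulr_sumr /objective -!sumrB; apply: ler_sum => i _.
  have := local_AL_first_order (xh_min i) (xs_in i).
  have -> : A i *m xh i + \sum_(j | j != i) A j *m x j - b = r + u i.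
    have -> : u i = A i *m xh i - A i *m x i by rewrite /u mulmxBr.
    by rewrite /r residualE [in RHS](bigD1 i)//= [RHS]addrC -!addrA addKr.
  have -> : A i *m (xs i - xh i) = - (w i + u i).
    by rewrite [w i + _]addrC /w /u !mulmxBr subrKA opprB.
  rewrite !dotE (dotC (u i) (w i)); lra.
have x'w i : A i *m (x' i - xs i) = w i + tau *: u i.
  by rewrite x'E addrAC mulmxDr -scalemxAr.
have coupling : dot rh rh - 2 * dot r rh + dot r r <= (degree A)%:R * U.
  have := dot_sum_le_degree A (fun i => xh i - x i).
  rewrite [\sum_i A i *m _]sumu; apply: le_trans; clearbody r rh.
  by rewrite !dotE (dotC rh r); lra.
have U_ge0 : 0 <= U by apply: sumr_ge0 => i _; exact: dot_ge0.
have lamE : lam + rho *: r = lbar + (rho * tau) *: r.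
  by rewrite lbarE /lam_bar -addrA -scalerDl mulrBr mulr1 subrK.
clearbody r rh.
have potE : potential mu x' (lbar + (rho * tau) *: rh) = potential mu x lbar
    + 2 * rho * tau * W + rho * tau ^+ 2 * U
    + 2 * tau * dot (lbar - mu) rh + rho * tau ^+ 2 * dot rh rh.
  rewrite /potential.
  have -> : \sum_i rho * enorm (A i *m (x' i - xs i)) ^+ 2
      = \sum_i rho * enorm (A i *m (x i - xs i)) ^+ 2
        + 2 * rho * tau * W + rho * tau ^+ 2 * U.
    rewrite /W /U !mulr_sumr -!big_split /=; apply: eq_bigr => i _.
    rewrite x'w !enorm_sqr -/(w i) !dotE (dotC (u i) (w i)); ring.
  have -> : enorm (lbar + (rho * tau) *: rh - mu) ^+ 2
      = enorm (lbar - mu) ^+ 2 + 2 * (rho * tau) * dot (lbar - mu) rh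
        + (rho * tau) ^+ 2 * dot rh rh.
    rewrite addrAC !enorm_sqr; move: (lbar - mu) => e.
    by rewrite !dotE (dotC rh e); ring.
  by field; rewrite gt_eqF.
have [tq t1] := stepsize_le.
have r_ge0 := dot_ge0 r.
move: optimality; rewrite lamE potE !dotE => opt.
(* the coupling term is paid for by tau * degree A <= 1 *)
have h1 : tau * (dot rh rh - 2 * dot r rh) <= U.
  have : tau * (dot rh rh - 2 * dot r rh + dot r r) <= tau * (degree A)%:R * U.
    by rewrite -mulrA ler_pM2l.
  have : tau * (degree A)%:R * U <= 1 * U by rewrite ler_wpM2r.
  have : 0 <= tau * dot r r by rewrite mulr_ge0// ltW.
  lra.
have h2 : tau * U <= U by rewrite -[leRHS]mul1r ler_wpM2r.
have h3 : rho * tau * (tau * U + tau * (dot rh rh - 2 * dot r rh) - 2 * U) <= 0.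
  by rewrite pmulr_rle0 ?mulr_gt0//; lra.
have h4 := ler_wpM2l (ltW tau_gt0) opt.
lra.
Qed.

Context (x xhat : nat -> blocks R n) (lam : nat -> 'cV[R]_m).
Context (run : adal f X A b rho tau x xhat lam).

Let lbar0 := lam_bar A b rho tau (x 0%N) (lam 0%N).

(* Unrolled form of the auxiliary multipliers. It is meaningful also for the
   iteration after the last one, where a run that stops leaves [lam]
   unconstrained. *)
Let lbar k := lbar0 + \sum_(p < k) (rho * tau) *: residual A b (xhat p).

Lemma adal_reaches_le p k :
  (p <= k)%N -> adal_reaches A b x xhat k -> adal_reaches A b x xhat p.
Proof. by move=> pk reach s sp; apply: reach; apply: leq_trans pk. Qed.

(** The multiplier step adds rho tau r(x^{k+1}), and the extra term
    rho (1 - tau) r(x^{k+1}) completes it to rho r(x^{k+1}) =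
    rho (1 - tau) r(x^k) + rho tau r(xhat^k). *)
Lemma lam_bar_run k : adal_reaches A b x xhat k ->
  lam_bar A b rho tau (x k) (lam k) = lbar k.
Proof.
elim: k => [|k IH] reach; first by rewrite /lbar big_ord0 addr0.
have reachk := adal_reaches_le (leqnSn k) reach.
have [_ xE /(_ (reach k (ltnSn k))) lamE] := run reachk.
rewrite /lbar big_ord_recr addrA -/(lbar k) -IH// /lam_bar lamE -residualE.
rewrite -(addrA (lam k)) -scalerDl (residual_relax xE) scalerDr !scalerA.
rewrite addrA -/(lbar k) /=.
have -> : rho * tau + rho * (1 - tau) = rho by ring.
by rewrite mulrC.
Qed.

Lemma potential_telescope mu k :
  (forall p, (p < k)%N -> adal_reaches A b x xhat p) ->
  potential mu (x k) (lbar k) + 2 * tau * \sum_(p < k)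
    (objective f (xhat p) - objective f xs + dot mu (residual A b (xhat p)))
  <= potential mu (x 0%N) lbar0.
Proof.
elim: k => [|k IH] reach; first by rewrite /lbar !big_ord0 !addr0 mulr0 addr0.
have reachk := reach k (ltnSn k).
have [xh_min xE _] := run reachk.
apply: le_trans (IH _) => [|p pk]; last by apply: reach; apply: ltnW.
rewrite /lbar !big_ord_recr /= addrA -/(lbar k) mulrDr addrCA addrC lerD2r.
apply: potential_decrease xh_min xE _.
by rewrite -lam_bar_run.
Qed.

Lemma objective_ergodic_le (xh : nat -> blocks R n) k : (0 < k)%N ->
  objective f (ergodic xh k) <= k%:R^-1 * \sum_(p < k) objective f (xh p).
Proof.
move=> k0; rewrite /objective exchange_big mulr_sumr; apply: ler_sum => i _.
exact: (convex_function_average (fun p => xh p i) (f_convex i) k0).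
Qed.

Lemma residual_ergodic (xh : nat -> blocks R n) k : (0 < k)%N ->
  residual A b (ergodic xh k) = k%:R^-1 *: \sum_(p < k) residual A b (xh p).
Proof.
move=> k0; have kn0 : k%:R != 0 :> R by rewrite pnatr_eq0 -lt0n.
under [in RHS]eq_bigr do rewrite residualE.
rewrite residualE sumrB scalerBr sumr_const card_ord -[b *+ k]scaler_nat.
rewrite scalerA mulVf// scale1r exchange_big scaler_sumr; congr (_ - _).
by apply: eq_bigr => i _; rewrite /ergodic -scalemxAr mulmx_sumr.
Qed.

(** The final potential is nonnegative and is dropped from the telescoped sum;
    the objective gap passes to the average by Jensen, the residual because it
    is affine. *)
Lemma ergodic_lagrangian_gap mu k :
  (0 < k)%N -> adal_reaches A b x xhat k.-1 ->
  objective f (ergodic xhat k) - objective f xs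
    + dot mu (residual A b (ergodic xhat k))
  <= (2 * k%:R * tau)^-1 * potential mu (x 0%N) lbar0.
Proof.
move=> k0 reach; have kp : 0 < k%:R :> R by rewrite ltr0n.
have reachp p : (p < k)%N -> adal_reaches A b x xhat p.
  by move=> pk; apply: adal_reaches_le reach; rewrite -ltnS prednK.
have pot_ge0 : 0 <= potential mu (x k) (lbar k).
  have rho_ge0 := ltW rho_gt0; apply: addr_ge0.
    by apply: sumr_ge0 => i _; rewrite mulr_ge0 ?exprn_ge0 ?enorm_ge0.
  by rewrite mulr_ge0 ?invr_ge0 ?exprn_ge0 ?enorm_ge0.
have := potential_telescope mu reachp.
rewrite big_split sumrB sumr_const card_ord /=.
rewrite -[objective f xs *+ k]mulr_natl -dot_sumr => tel.
rewrite residual_ergodic// dotZr.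
have Fle := objective_ergodic_le xhat k0.
have {}Fle := ler_wpM2l (ltW kp) Fle; rewrite mulVKf ?gt_eqF// in Fle.
rewrite ler_pdivlMl ?mulr_gt0//.
apply: le_trans tel.
set S := \sum_(p < k) objective f (xhat p) in Fle *.
set D := dot mu _.
have -> : 2 * k%:R * tau * (objective f (ergodic xhat k) - objective f xs
    + k%:R^-1 * D)
  = 2 * tau * (k%:R * objective f (ergodic xhat k) - k%:R * objective f xs + D).
  by field; rewrite gt_eqF.
apply: ler_wpDl => //; rewrite ler_pM2l ?mulr_gt0// lerD2r.
by rewrite lerD2r.
Qed.

(** The unit vector along the residual turns the pairing into a norm and, as
    lbar0 = 0, contributes at most 1 to the dual part of the initial potential;
    if the residual is 0, this vector is 0 and both facts persist. *)
Lemma ergodic_rate k : lbar0 = 0 ->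
  (0 < k)%N -> adal_reaches A b x xhat k.-1 ->
  objective f (ergodic xhat k) - objective f xs
    + enorm (residual A b (ergodic xhat k))
  <= (2 * k%:R * tau)^-1 * phi A rho (x 0%N) xs lbar0.
Proof.
move=> lbar0E k0 reach; set r := residual A b _.
have := ergodic_lagrangian_gap ((enorm r)^-1 *: r) k0 reach.
rewrite -/r dot_normalize => /le_trans; apply.
have rho_ge0 := ltW rho_gt0.
rewrite ler_wpM2l ?invr_ge0 ?mulr_ge0 ?ler0n ?(ltW tau_gt0)//.
rewrite /potential /phi lbar0E enorm0 !add0r expr1n lerD2l.
rewrite ler_wpM2l ?invr_ge0// enorm_sqr dotNl dotNr opprK -enorm_sqr.
by rewrite expr_le1 ?enorm_ge0// enorm_normalize_le1.
Qed.

End ADAL.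

(** L(x*, .) is affine in the multiplier with slope r(x* ), so a bounded maximum
    forces r(x* ) = 0; the increment r(x* ) itself is the test direction. *)
Lemma saddle_point_feasible (R : realType) (N m : nat) (n : 'I_N -> nat)
    (f : forall i : 'I_N, 'cV[R]_(n i) -> R)
    (X : forall i : 'I_N, set 'cV[R]_(n i))
    (A : forall i : 'I_N, 'M[R]_(m, n i)) (b : 'cV[R]_m)
    (xs : blocks R n) (lams : 'cV[R]_m) :
  saddle_point f X A b xs lams -> residual A b xs = 0.
Proof.
move=> [_ /(_ (lams + residual A b xs)) + _].
rewrite /lagrangian dotDl addrA gerDl => le0.
by apply/eqP; rewrite -[_ == 0]dot_eq0 eq_le le0 dot_ge0.
Qed.

(** * The optimal penalty parameter and the iteration count *)

Section PenaltyChoice.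
Context {R : realType} {N m : nat} {n : 'I_N -> nat}.
Context (X : forall i : 'I_N, set 'cV[R]_(n i)).
Context (A : forall i : 'I_N, 'M[R]_(m, n i)) (x0 : blocks R n).
Context (x0_in : in_prod X x0).
Context (sigma_gt0 : 0 < sigma_max (full_mx A)) (diam_gt0 : 0 < diameter X).

Let a : R := Num.sqrt N%:R * sigma_max (full_mx A) * diameter X.

(** Only sqrt N > 0 needs an argument: without blocks all points coincide and
    the diameter vanishes. *)
Lemma bound_scale_gt0 : 0 < a.
Proof.
rewrite !mulr_gt0// sqrtr_gt0 ltr0n lt0n; apply/eqP => N0.
move: diam_gt0; rewrite ltNge => /negP; apply; apply: ge_sup.
  by exists (enorm (stack x0 - stack x0)), x0, x0.
move=> _ [y [z [_ _ ->]]]; rewrite stackB /enorm dot_stack big1 ?sqrtr0// => i.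
by have := leq_ltn_trans (leq0n i) (ltn_ord i); rewrite N0.
Qed.

Lemma rho_boundE rho : rho_bound X A rho = rho * a ^+ 2 + rho^-1.
Proof. by rewrite /rho_bound /a !exprMn sqr_sqrtr ?ler0n// !mulrA. Qed.

Lemma rho_bound_opt : rho_bound X A (rho_opt X A) = 2 * a.
Proof.
rewrite rho_boundE /rho_opt -/a; field.
by rewrite gt_eqF ?bound_scale_gt0.
Qed.

Lemma rho_bound_min rho : 0 < rho -> rho != rho_opt X A ->
  rho_bound X A (rho_opt X A) < rho_bound X A rho.
Proof.
move=> rho0 rho_neq; rewrite rho_bound_opt rho_boundE -subr_gt0.
have -> : rho * a ^+ 2 + rho^-1 - 2 * a = (rho * a - 1) ^+ 2 / rho.
  by field; rewrite gt_eqF.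
rewrite divr_gt0// lt0r sqr_ge0 andbT sqrf_eq0 subr_eq0.
apply: contra_neq rho_neq => rhoa; rewrite /rho_opt -/a.
have a_neq0 := lt0r_neq0 bound_scale_gt0.
by apply: (mulIf a_neq0); rewrite rhoa mulVf.
Qed.

Lemma k_eps_le tau eps k : 0 < tau -> 0 < eps -> (0 < k)%N ->
  ((2 * k%:R * tau)^-1 * rho_bound X A (rho_opt X A) <= eps)
  = (k_eps X A tau eps <= k%:Z).
Proof.
move=> tau0 eps0 k0; have kp : 0 < k%:R :> R by rewrite ltr0n.
rewrite rho_bound_opt ceil_le_int -/a ler_pdivrMl ?mulr_gt0//.
rewrite ler_pdivrMr ?mulr_gt0// -pmulrn.
have -> : 2 * k%:R * tau * eps = 2 * (k%:R * (eps * tau)) by ring.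
by rewrite ler_pM2l.
Qed.

End PenaltyChoice.

Theorem proposition1 (R : realType) (N m : nat) (n : 'I_N -> nat)
    (f : forall i : 'I_N, 'cV[R]_(n i) -> R)
    (X : forall i : 'I_N, set 'cV[R]_(n i))
    (A : forall i : 'I_N, 'M[R]_(m, n i)) (b : 'cV[R]_m)
    (xs x0 : blocks R n) (lams : 'cV[R]_m)
    (f_convex : forall i, convex_function setT (f i))
    (X_convex : forall i, convex_set (X i))
    (X_closed : forall i, closed (X i))
    (X_bounded : forall i, bounded_set (X i))
    (saddle : saddle_point f X A b xs lams)
    (x0_in : in_prod X x0) :
  (forall rho : R, 0 < rho ->
     \sum_i rho * enorm (A i *m (x0 i - xs i)) ^+ 2 + rho^-1
       <= rho_bound X A rho)
  /\
  (0 < sigma_max (full_mx A) -> 0 < diameter X ->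
     0 < rho_opt X A /\
     forall rho : R, 0 < rho -> rho != rho_opt X A ->
       rho_bound X A (rho_opt X A) < rho_bound X A rho)
  /\
  (forall (rho tau : R) (x xhat : nat -> blocks R n) (lam : nat -> 'cV[R]_m)
      (k : nat),
     0 < rho -> 0 < tau < (degree A)%:R^-1 ->
     x 0%N = x0 -> lam_bar A b rho tau x0 (lam 0%N) = 0 ->
     adal f X A b rho tau x xhat lam ->
     (0 < k)%N -> adal_reaches A b x xhat k.-1 ->
     objective f (ergodic xhat k) - objective f xs
       + enorm (residual A b (ergodic xhat k))
     <= (2 * k%:R * tau)^-1
        * phi A rho x0 xs (lam_bar A b rho tau x0 (lam 0%N)))
  /\
  (0 < sigma_max (full_mx A) -> 0 < diameter X ->
   forall tau eps : R, 0 < tau < (degree A)%:R^-1 -> 0 < eps ->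
     (forall k : nat, (0 < k)%N ->
        ((2 * k%:R * tau)^-1 * rho_bound X A (rho_opt X A) <= eps
         <-> k_eps X A tau eps <= k%:Z))
     /\
     (forall (x xhat : nat -> blocks R n) (lam : nat -> 'cV[R]_m) (k : nat),
        x 0%N = x0 -> lam_bar A b (rho_opt X A) tau x0 (lam 0%N) = 0 ->
        adal f X A b (rho_opt X A) tau x xhat lam ->
        (0 < k)%N -> k_eps X A tau eps <= k%:Z ->
        adal_reaches A b x xhat k.-1 ->
        objective f (ergodic xhat k) - objective f xs
          + enorm (residual A b (ergodic xhat k))
        <= (2 * k%:R * tau)^-1
           * phi A (rho_opt X A) x0 xs
               (lam_bar A b (rho_opt X A) tau x0 (lam 0%N))
        <= eps)).
Proof.
have xs_in : in_prod X xs by case: saddle.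
have xs_feasible := saddle_point_feasible saddle.
have phi0_le (rho : R) : 0 < rho ->
    phi A rho x0 xs 0 <= rho_bound X A rho.
  move=> rho0; rewrite /phi enorm0 add0r expr1n mulr1.
  exact: sum_enorm_le_rho_bound.
have rate (rho tau : R) (x xhat : nat -> blocks R n) (lam : nat -> 'cV[R]_m)
    (k : nat) :
     0 < rho -> 0 < tau < (degree A)%:R^-1 ->
     x 0%N = x0 -> lam_bar A b rho tau x0 (lam 0%N) = 0 ->
     adal f X A b rho tau x xhat lam ->
     (0 < k)%N -> adal_reaches A b x xhat k.-1 ->
     objective f (ergodic xhat k) - objective f xs
       + enorm (residual A b (ergodic xhat k))
     <= (2 * k%:R * tau)^-1
        * phi A rho x0 xs (lam_bar A b rho tau x0 (lam 0%N)).
  move=> rho0 /andP[tau0 tau1] <- lbar0 run k0 reach.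
  exact: ergodic_rate.
split; first by move=> rho rho0; exact: sum_enorm_le_rho_bound.
split.
  move=> s0 D0; split; first by rewrite invr_gt0 (bound_scale_gt0 x0_in).
  by move=> rho; exact: (rho_bound_min x0_in).
split; first exact: rate.
move=> s0 D0 tau eps tau01 eps0; have /andP[tau0 _] := tau01.
have k_epsE := k_eps_le x0_in s0 D0 tau0 eps0.
split=> [k k0|x xhat lam k xE lbar0 run k0 k_large reach].
  by rewrite k_epsE.
have rho0 : 0 < rho_opt X A by rewrite invr_gt0 (bound_scale_gt0 x0_in).
apply/andP; split; first exact: (rate _ _ x).
rewrite -k_epsE// in k_large; apply: le_trans k_large.
by rewrite lbar0 ler_wpM2l ?phi0_le// invr_ge0 !mulr_ge0 ?ler0n ?(ltW tau0).
Qed.
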